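(* Let $k\ge 3$ and let $\pi=\pi(1)\cdots\pi(k)$ be a permutation of $[k]$ with $\pi(k)=\pi(k-1)+1=\pi(k-2)+2$. Let $\widetilde\pi=\pi(1)\cdots\pi(k-2)\pi(k)\pi(k-1)$ be the pattern obtained by swapping the last two entries. Then $\{213,\pi\}$ and $\{213,\widetilde\pi\}$ are forest-Wilf equivalent: for every $n\ge 0$, the number of rooted labeled forests on $[n]$ avoiding both $213$ and $\pi$ equals the number of rooted labeled forests on $[n]$ avoiding both $213$ and $\widetilde\pi$.
   Context: A rooted labeled forest on $[n]$ is an unordered (non-planar) forest on $n$ vertices, each component having a distinguished root, whose vertices carry distinct labels from $[n]$; $u$ is an ancestor of $v$ if $u$ lies on the path from the root of $v$'s component to $v$. A pattern is a permutation $\pi$ of $[k]$. An instance of $\pi$ in a forest is a sequence of vertices $v_1,\dots,v_k$ with $v_i$ a strict ancestor of $v_{i+1}$ for all $i$ and whose labels are in the same relative order as $\pi(1),\dots,\pi(k)$. A forest avoids a set of patterns if it contains no instance of any of them. *)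

(* Defs.v *)
From mathcomp Require Import all_boot.
Set Implicit Arguments. Unset Strict Implicit. Unset Printing Implicit Defensive.

(* A rooted labeled forest on [n] is encoded by its parent function:
   vertices are 'I_n (label i+1 <-> vertex i; only relative order matters),
   par v = None iff v is a root, par v = Some u iff u is the parent of v.
   This is a bijection with rooted labeled (unordered) forests provided the
   parent relation is acyclic. *)
Definition parent_fun (n : nat) := {ffun 'I_n -> option 'I_n}.

Definition up n (par : parent_fun n) (o : option 'I_n) : option 'I_n :=
  if o is Some v then par v else None.

Definition is_forest n (par : parent_fun n) : bool :=
  [forall v : 'I_n, iter n (up par) (Some v) == None].

(* u is a strict ancestor of v: u = par^(m) v for some m >= 1 (m <= n suffices) *)
Definition strict_anc n (par : parent_fun n) (u v : 'I_n) : bool :=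
  [exists m : 'I_n, iter m.+1 (up par) (Some v) == Some u].

(* a pattern is a sequence of naturals (a permutation of 1..k);
   an instance is a chain v_1,...,v_k, v_i strict ancestor of v_(i+1),
   labels order-isomorphic to the pattern *)
Definition contains n (par : parent_fun n) (p : seq nat) : bool :=
  [exists v : {ffun 'I_(size p) -> 'I_n},
     [forall i : 'I_(size p), forall j : 'I_(size p),
        ((j : nat) == i.+1) ==> strict_anc par (v i) (v j)] &&
     [forall i : 'I_(size p), forall j : 'I_(size p),
        ((v i < v j) == (nth 0 p i < nth 0 p j))]].

Definition avoids n (par : parent_fun n) (S : seq (seq nat)) : bool :=
  all (fun p => ~~ contains par p) S.

Definition num_avoiding (S : seq (seq nat)) (n : nat) : nat :=
  #|[set par : parent_fun n | is_forest par && avoids par S]|.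

Definition swap_last2 (p : seq nat) : seq nat :=
  let k := size p in take (k - 2) p ++ [:: nth 0 p (k - 1); nth 0 p (k - 2)].

(* Main.v *)
(* Let [p] be the pattern without its last two entries, call a vertex [v] marked
   if an occurrence of [p] ends at [v], and let [F v] be the set of descendants
   of [v] with a larger label.  In a 213-avoiding forest, any ancestor of [v]
   with a label larger than [v] has a label larger than all of [F v], so the
   forest avoids [pi] (resp. its swap) iff the labels decrease (resp. increase)
   along every path in [F v], for every marked [v].  The sets [F v] form a
   laminar family, and the labels of a vertex outside [F v] compare in the same
   way to all the vertices of [F v] with which it shares a path.  Hence
   reversing the order of the labels within each maximal [F v], [v] marked,
   keeps 213 avoided and exchanges the two conditions.  This map is an involution
   because it does not change which vertices outside these sets are marked: an
   exchange argument shows that such a marked vertex is the end of an occurrence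
   of [p] that uses no vertex of these sets. *)
Require Import Defs.
From mathcomp Require Import all_boot.
From mathcomp Require Import zify.
Set Implicit Arguments. Unset Strict Implicit. Unset Printing Implicit Defensive.

(** * Order reversal on a sorted sequence *)

Section ReverseSeq.
Variables (T : eqType) (lt : rel T) (s : seq T).
Definition rev_in (x : T) : T := nth x s (size s - (index x s).+1).

Lemma rev_in_in x : x \in s -> rev_in x \in s.
Proof. by move=> xs; apply: mem_nth; have := xs; rewrite -index_mem; lia. Qed.

Hypotheses (lt_irr : irreflexive lt) (lt_trans : transitive lt).
Hypothesis lt_s : sorted lt s.

Lemma index_rev_in x : x \in s ->
  index (rev_in x) s = size s - (index x s).+1.
Proof.
move=> xs; have := xs; rewrite -index_mem => lt_xs.
by rewrite index_uniq ?(sorted_uniq lt_trans lt_irr) //; lia.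
Qed.

Lemma rev_inK x : x \in s -> rev_in (rev_in x) = x.
Proof.
move=> xs; have := xs; rewrite -index_mem => lt_xs.
rewrite {1}/rev_in index_rev_in //.
have -> : size s - (size s - (index x s).+1).+1 = index x s by lia.
exact: nth_index.
Qed.

Lemma rev_in_lt x y : x \in s -> y \in s -> lt x y -> lt (rev_in y) (rev_in x).
Proof.
move=> xs ys xy; have := xs; have := ys; rewrite -!index_mem => ly lx.
have nth_lt i j : i < j -> j < size s -> lt (nth x s i) (nth x s j).
  by move=> ij js; apply: sorted_ltn_nth => //; rewrite inE; lia.
have ixy : index x s < index y s.
  case: ltngtP => // [yx|E].
    have := nth_lt _ _ yx lx; rewrite !nth_index // => yx'.
    by have := lt_trans xy yx'; rewrite lt_irr.
  have E' : x = y by rewrite -(nth_index x xs) -(nth_index x ys) E.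
  by rewrite E' lt_irr in xy.
by rewrite /rev_in (set_nth_default x) ?nth_lt //; lia.
Qed.

End ReverseSeq.

Lemma sorted_enum_ord n (B : {set 'I_n}) :
  sorted (fun x y : 'I_n => x < y) (enum B).
Proof.
rewrite /enum_mem -enumT; apply: sorted_filter.
  by move=> y x z; apply: ltn_trans.
by have := iota_ltn_sorted 0 n; rewrite -val_enum_ord sorted_map.
Qed.

(** * The strict ancestor relation of a forest *)

Section Ancestors.
Variables (n : nat) (f : parent_fun n).
Hypothesis forest_f : is_forest f.

Lemma iter_up_None m : iter m (up f) None = None.
Proof. by elim: m => //= m ->. Qed.

Lemma iter_up_large m v : n <= m -> iter m (up f) (Some v) = None.
Proof.
move=> nm; rewrite -(subnK nm) iterD.
by move/forallP/(_ v)/eqP: forest_f => ->; rewrite iter_up_None.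
Qed.

Lemma strict_ancP u v :
  reflect (exists m, iter m.+1 (up f) (Some v) = Some u) (strict_anc f u v).
Proof.
apply: (iffP existsP) => [[m /eqP E]|[m E]]; first by exists m.
have mn : m < n.
  by rewrite ltnNge; apply/negP => nm; rewrite iter_up_large // in E; lia.
by exists (Ordinal mn); apply/eqP.
Qed.

Lemma anc_trans v u w :
  strict_anc f u v -> strict_anc f v w -> strict_anc f u w.
Proof.
move=> /strict_ancP[a Ea] /strict_ancP[b Eb]; apply/strict_ancP.
by exists (a + b.+1); rewrite -addSn iterD Eb.
Qed.

(** A cycle through [v] could be followed [n] times, whereas every upward path ends within [n]
    steps. *)
Lemma anc_irr v : ~ strict_anc f v v.
Proof.
case/strict_ancP=> m E.
have H k : iter (k * m.+1) (up f) (Some v) = Some v.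
  by elim: k => // k IH; rewrite mulSn iterD IH.
by have := H n; rewrite iter_up_large //; lia.
Qed.

Lemma anc_neq x y : strict_anc f x y -> x != y :> nat.
Proof.
by move=> a; apply/eqP => E; move: a; rewrite (val_inj E); apply: anc_irr.
Qed.

Lemma anc_comparable u v w : strict_anc f u w -> strict_anc f v w ->
  [\/ u = v, strict_anc f u v | strict_anc f v u].
Proof.
have aux a b x y : a < b -> iter a.+1 (up f) (Some w) = Some x ->
    iter b.+1 (up f) (Some w) = Some y -> strict_anc f y x.
  move=> ab Ex Ey; apply/strict_ancP; exists (b - a).-1.
  have -> : (b - a).-1.+1 = b.+1 - a.+1 by lia.
  by rewrite -Ex -iterD subnK // ltnS ltnW.
move=> /strict_ancP[a Ea] /strict_ancP[b Eb].
case: (ltngtP a b) => [ab|ba|E].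
- by constructor 3; apply: aux Ea Eb.
- by constructor 2; apply: aux Eb Ea.
- by constructor 1; rewrite E Eb in Ea; case: Ea.
Qed.

End Ancestors.

(** * Relabeling a forest by an involution *)

Section Relabel.
Variables (n : nat) (f : parent_fun n) (s : 'I_n -> 'I_n).
Hypothesis sK : involutive s.

(** Vertex [v] receives the label [s v]. The parent function is conjugated, with [s] serving as its
    own inverse. *)
Definition relabel : parent_fun n := [ffun x => omap s (f (s x))].

Lemma iter_up_relabel m o :
  iter m (up relabel) (omap s o) = omap s (iter m (up f) o).
Proof.
elim: m => //= m ->; case: (iter m _ o) => //= x.
by rewrite ffunE sK.
Qed.

Lemma is_forest_relabel : is_forest f -> is_forest relabel.
Proof.
move=> /forallP F; apply/forallP => v.
by rewrite -(sK v) (iter_up_relabel n (Some (s v))) (eqP (F (s v))).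
Qed.

Lemma anc_relabel u v : strict_anc relabel u v = strict_anc f (s u) (s v).
Proof.
apply: eq_existsb => m.
rewrite -{1}(sK v) (iter_up_relabel m.+1 (Some (s v))).
case: (iter _ _ _) => //= x.
by apply/eqP/eqP => -[]; [move=> <-|move=> ->]; rewrite sK.
Qed.

End Relabel.

(** * Occurrences of patterns and marked vertices *)

Section Occurrences.
Variables (n : nat).
Implicit Types (f : parent_fun n) (p : nat -> nat).

Definition avoids213 f := forall x y z,
  strict_anc f x y -> strict_anc f y z -> y < x -> x < z -> False.

(* Indices [0..M]: only the entries [p 0, ..., p M] of the pattern matter. *)
Definition occ f p M (I : nat -> 'I_n) := forall i j, i < j -> j <= M ->
  strict_anc f (I i) (I j) /\ (I i < I j) = (p i < p j).

Definition marked p M f (v : 'I_n) : bool :=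
  [exists I : {ffun 'I_M.+1 -> 'I_n}, (I ord_max == v) &&
     [forall i : 'I_M.+1, forall j : 'I_M.+1, (i < j) ==>
       strict_anc f (I i) (I j) && ((I i < I j) == (p i < p j))]].

Lemma markedP p M f v :
  reflect (exists2 I, occ f p M I & I M = v) (marked p M f v).
Proof.
apply: (iffP existsP) => [[I /andP[/eqP Iv /forallP H]]|[I H Iv]].
  exists (fun i => I (inord i)) => [i j ij jM|].
    have iE : (inord i : 'I_M.+1) = i :> nat by rewrite inordK //; lia.
    have jE : (inord j : 'I_M.+1) = j :> nat by rewrite inordK //; lia.
    have /forallP/(_ (inord j)) := H (inord i).
    by rewrite iE jE ij => /andP[-> /eqP ->].
  by rewrite -Iv; congr (I _); apply: val_inj; rewrite /= inordK.
exists [ffun i : 'I_M.+1 => I i]; rewrite ffunE /= Iv eqxx /=.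
apply/forallP => i; apply/forallP => j; apply/implyP => ij.
have [||a l] := H i j; rewrite ?ffunE ?a ?l ?eqxx //.
by rewrite -ltnS.
Qed.

(** [contains] asks ancestry of consecutive indices and order of all pairs; [occ] asks both for
    [i < j]. The gaps are filled by transitivity of ancestry, and by distinctness of the entries and
    of the labels on a path. *)
Lemma containsP f (q : seq nat) M : is_forest f -> uniq q -> size q = M.+1 ->
  reflect (exists I, occ f (nth 0 q) M I) (contains f q).
Proof.
move=> ff uq sq; have q0 : 0 < size q by rewrite sq.
apply: (iffP existsP) => [[v /andP[/forallP C /forallP O]]|[I H]].
  pose I i := v (insubd (Ordinal q0) i).
  have IE i : i < size q -> val (insubd (Ordinal q0) i) = i.
    by move=> iq; rewrite val_insubd iq.
  exists I => i j ij jM; split; last first.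
    have /forallP/(_ (insubd (Ordinal q0) j)) := O (insubd (Ordinal q0) i).
    by rewrite !IE; [move/eqP | lia..].
  elim: j ij jM => // j IH ij jM.
  have step : strict_anc f (I j) (I j.+1).
    have /forallP/(_ (insubd (Ordinal q0) j.+1)) := C (insubd (Ordinal q0) j).
    by rewrite !IE ?eqxx //; lia.
  move: ij; rewrite ltnS leq_eqVlt => /orP[/eqP -> //|ij].
  by apply: anc_trans step => //; apply: IH => //; lia.
exists [ffun i : 'I_(size q) => I i]; apply/andP; split.
  apply/forallP => i; apply/forallP => j; apply/implyP => /eqP ji.
  by rewrite !ffunE; have [||//] := H i j; [lia | have := ltn_ord j; lia].
apply/forallP => i; apply/forallP => j; rewrite !ffunE; apply/eqP.
have iq := ltn_ord i; have jq := ltn_ord j.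
case: (ltngtP i j) => [ij|ji|->]; last by rewrite !ltnn.
  by have [||_ ->//] := H i j; lia.
have [||a l] := H j i; try lia.
have := anc_neq ff a.
have : nth 0 q i != nth 0 q j by rewrite nth_uniq //; lia.
lia.
Qed.

End Occurrences.

(** * The exchange argument *)

Lemma run_start (P : pred nat) j : P j ->
  exists b, [/\ b <= j, forall r, b <= r <= j -> P r & 0 < b -> ~~ P b.-1].
Proof.
elim: j => [|j IH] Pj.
  by exists 0; split=> // r; rewrite leqn0 => /andP[_ /eqP ->].
have [Pj'|nPj'] := boolP (P j); last first.
  by exists j.+1; split=> // r rj; have -> : r = j.+1 by lia.
have [b [bj Hb b0]] := IH Pj'; exists b; split=> // [|r /andP[br]]; first lia.
by rewrite leq_eqVlt => /orP[/eqP -> //|rj]; apply: Hb; lia.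
Qed.

Section Exchange.
Variables (n : nat) (f : parent_fun n) (p : nat -> nat) (M : nat).
Hypotheses (forest_f : is_forest f) (av : avoids213 f).
Hypothesis p_inj : forall i j, i <= M -> j <= M -> p i = p j -> i = j.

(** [J] would carry a 213 of the pattern to a 213 of the forest. *)
Lemma pattern_avoids213 J i j k : occ f p M J ->
  i < j -> j < k -> k <= M -> p j < p i -> p i < p k -> False.
Proof.
move=> oJ ij jk kM ji ik.
have [||a1 l1] := oJ i j; try lia.
have [||a2 l2] := oJ j k; try lia.
have [||a3 l3] := oJ i k; try lia.
have nlt : ~~ (J i < J j) by rewrite l1; lia.
have ne := anc_neq forest_f a1.
by apply: (av a1 a2); [lia | rewrite l3].
Qed.

(* Entries of the pattern above [p M] are called big.  By 213-avoidance the small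
   entries increase and the runs of big entries between them decrease, so the run
   containing [j] can be imported from [J], which is fully completed by [J M],
   before [I j].  If the small entry preceding the run comes later in [I] than in
   [J], everything up to the end of the run is imported. *)
Lemma exchange I J j : occ f p M I -> occ f p M J -> j < M ->
  strict_anc f (J M) (I j) -> J M < I j -> I M < J M ->
  (forall q, j < q -> q <= M -> I q <= J M) ->
  exists K c e, [/\ occ f p M K, c <= j, j < e, e <= M &
    forall q, K q = if c <= q < e then J q else I q].
Proof.
move=> oI oJ jM vj vltj sv small_after.
have no213 := pattern_avoids213 oJ.
have lt_I i q : i < q -> q <= M -> (I i < I q) = (p i < p q).
  by move=> iq qM; have [||_ ->] := oI i q.
have lt_J i q : i < q -> q <= M -> (J i < J q) = (p i < p q).
  by move=> iq qM; have [||_ ->] := oJ i q.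
have anc_I i q : i < q -> q <= M -> strict_anc f (I i) (I q).
  by move=> iq qM; have [||-> _] := oI i q.
have anc_J i q : i < q -> q <= M -> strict_anc f (J i) (J q).
  by move=> iq qM; have [||-> _] := oJ i q.
have tr := anc_trans forest_f.
have anc_neq := anc_neq forest_f.
have p_neq i q : i < q -> q <= M -> p i != p q.
  by move=> iq qM; apply/eqP => /p_inj E; have := E; lia.
have bigj : p M < p j.
  by have := lt_I j M jM (leqnn _); have := p_neq j M jM (leqnn _); lia.
(* The run of big entries around [j] is [[b, e)]: [e] is the first index after [j] whose entry is
   not big, and [M] is a candidate. *)
have [e [je eM pe run_e]] : exists e, [/\ j < e, e <= M, p e <= p M &
    forall q, j < q < e -> p M < p q].
  have ex : exists q, [&& j < q, q <= M & p q <= p M].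
    by exists M; rewrite jM !leqnn.
  case: (ex_minnP ex) => e /and3P[je eM pe] min_e; exists e; split=> // q qe.
  rewrite ltnNge; apply/negP => pq; have := min_e q.
  by rewrite pq /=; lia.
have [b [bj run_b b0]] := run_start (P := fun q => p M < p q) bigj.
have big_run q : b <= q < e -> p M < p q.
  by move=> qe; case: (leqP q j) => qj; [apply: run_b | apply: run_e]; lia.
have pb : 0 < b -> p b.-1 < p M.
  by move=> bp; have := b0 bp; have := p_neq b.-1 M; lia.
have smallI i : i < M -> p i < p M -> I i < I M by move=> iM; rewrite lt_I.
have bigJ i : i < M -> p M < p i -> J M < J i.
  move=> iM bi; have := lt_J i M iM (leqnn _).
  have := anc_neq _ _ (anc_J i M iM (leqnn _)).
  lia.
have v_anc q : e <= q -> q <= M -> strict_anc f (J M) (I q).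
  by move=> eq qM; apply: tr vj _; apply: anc_I => //; lia.
have Iq_lt q : e <= q -> q <= M -> I q < J M.
  move=> eq qM; have := small_after q; have := anc_neq _ _ (v_anc q eq qM); lia.
(* The import starts at the run, or at 0 if [I b.-1] has a larger label than [J b.-1]; for [b = 0]
   both choices agree. *)
have [c Hc] : exists c, [/\ c = b, 0 < b & I b.-1 <= J b.-1] \/
    c = 0 /\ (0 < b -> J b.-1 < I b.-1).
  case: (posnP b) => [bz|bp]; first by exists 0; right; split=> //; lia.
  by case: (leqP (I b.-1) (J b.-1)) => h; [exists b; left | exists 0; right].
have cb : c <= b by case: Hc => -[] ->.
exists (fun q => if c <= q < e then J q else I q), c, e; split=> //; last lia.
move=> i q iq qM /=.
case: ifP => iin; case: ifP => qin; try by [split; [apply: anc_J | apply: lt_J]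
  | split; [apply: anc_I | apply: lt_I]].
(* Here [i] is imported and [q], after the run, is kept: [J M] lies between them on the path and
   [I q < J M]. If [p i] is big, then [p q < p i], as otherwise [i], [e], [q] would form a 213 in
   the pattern. *)
- have eq : e <= q by lia.
  split.
    have [->|ne] := eqVneq i M; first exact: v_anc.
    by apply: tr (v_anc q eq qM); apply: anc_J => //; lia.
  have := Iq_lt q eq qM => Iqv.
  have [bi|] := ltnP (p M) (p i).
    have := bigJ i _ bi.
    have : p q < p i.
      case: (ltngtP (p q) (p M)) => [||->]; [lia| |lia].
      move=> bq; have [E|ne] := eqVneq e q; first by move: bq; rewrite -E; lia.
      have pe' : p e < p M by have := p_neq e M; lia.
      case: (ltngtP (p q) (p i)) => // [lt|E].
        by case: (no213 i e q); lia.
      by have := p_neq i q iq qM; lia.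
    lia.
  (* A small imported entry precedes the run, so the import starts at 0. Then
     [J i <= J b.-1 < I b.-1 < I q], because small entries increase. *)
  have iM : i < M by lia.
  have := p_neq i M iM (leqnn _) => ne le.
  have ib : i < b by rewrite ltnNge; apply/negP => bi; have := big_run i; lia.
  have bp : 0 < b by lia.
  have Jb : J b.-1 < I b.-1 by case: Hc => -[]; [lia|move=> _; apply].
  have piq r : r < q -> p r < p M -> p r < p q.
    move=> rq sr; case: (ltngtP (p q) (p M)) => [lt||->//]; last lia.
    have qM' : q < M by case: (ltngtP q M) => // [|E]; [lia|rewrite E in lt; lia].
    case: (ltngtP (p r) (p q)) => // [gt|E]; first by case: (no213 r q M); lia.
    by have := p_neq r q rq qM; lia.
  have Ji : J i <= J b.-1.
    have [-> //|nib] := eqVneq i b.-1.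
    rewrite ltnW // lt_J; try lia.
    case: (ltngtP (p i) (p b.-1)) => // [gt|E].
      by case: (no213 i b.-1 M) => //; lia.
    by have := p_neq i b.-1; lia.
  have := lt_I b.-1 q; rewrite !piq; lia.
(* Here [i] is kept and [q] is imported, so [c = b > 0]. Two uses of 213-avoidance put [I b.-1]
   above [J M], then above every [J r] with [r >= b]. A big [I i] exceeds [J q], or [I i], [I b.-1],
   [J q] would form a 213. *)
- have [E bp Ib] : [/\ c = b, 0 < b & I b.-1 <= J b.-1].
    by case: Hc => [[]|[]]; split; lia.
  have bM : b.-1 < M by lia.
  have Ibs : I b.-1 < I M by apply: smallI => //; apply: pb.
  have Iv : strict_anc f (I b.-1) (J M).
    have ij : strict_anc f (I b.-1) (I j) by apply: anc_I; lia.
    have [E'|//|a] := anc_comparable forest_f ij vj; first by rewrite E' in Ibs; lia.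
    by case: (av a ij); lia.
  have Jv := anc_J b.-1 M bM (leqnn _).
  have aJb : forall r, b.-1 < r -> r <= M -> strict_anc f (I b.-1) (J r).
    move=> r br rM; have a := anc_J b.-1 r br rM.
    have [->//|a'|a'] := anc_comparable forest_f Iv Jv; first exact: tr a.
    by case: (av a' Iv); have := anc_neq _ _ a';
      have := lt_J b.-1 M bM (leqnn _); have := pb bp; lia.
  have qv : J M < J q by apply: bigJ; [lia | apply: big_run; lia].
  have bq : p M < p q by apply: big_run; lia.
  have aq : strict_anc f (I b.-1) (J q) by apply: aJb; lia.
  have [Eib|nib] := eqVneq i b.-1.
    rewrite Eib; split=> //; have := pb bp; lia.
  have aib : strict_anc f (I i) (I b.-1) by apply: anc_I; lia.
  split; first exact: tr aq.
  have := pb bp => pb'.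
  have [|bi] := ltnP (p i) (p M).
    by move=> si; have := smallI i; lia.
  have biM : p M < p i by have := p_neq i M; lia.
  have pqi : p q < p i.
    case: (ltngtP (p q) (p i)) => // [lt|E']; first by case: (no213 i b.-1 q); lia.
    by have := p_neq i q iq qM; lia.
  have Ibi : I b.-1 < I i by have := lt_I i b.-1; have := anc_neq _ _ aib; lia.
  have : ~ I i < J q by move=> h; apply: av aib aq Ibi h.
  lia.
Qed.

End Exchange.

(** * The sets [F v], written [upper f v], their maximal members, and the reversal of labels *)

Definition upper n (f : parent_fun n) (v x : 'I_n) : bool :=
  strict_anc f v x && (v < x).

Section Blocks.
Variables (n : nat) (p : nat -> nat) (M : nat).
Implicit Types f : parent_fun n.

Definition covered f (x : 'I_n) : bool :=
  [exists v, marked p M f v && upper f v x].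

(** If [w] covers a marked vertex [v], then [F v] lies inside [F w]; so the sets of the tops suffice
    to cover. A block is named by its top. *)
Definition top f v : bool := marked p M f v && ~~ covered f v.

Definition block f (x : 'I_n) : option 'I_n := [pick v | top f v && upper f v x].

Definition flip f (x : 'I_n) : 'I_n :=
  if block f x is Some _ then rev_in (enum [set y | block f y == block f x]) x
  else x.

(** Labels increase along paths inside each [F v] for [d = true], and decrease for [d = false]. *)
Definition monotone d f := forall v x y, marked p M f v ->
  upper f v x -> upper f v y -> strict_anc f x y -> (x < y) = d.

Section OneForest.
Variable f : parent_fun n.
Hypotheses (forest_f : is_forest f) (av : avoids213 f).

Lemma upper_trans v u w : upper f u v -> upper f v w -> upper f u w.
Proof.
move=> /andP[a l] /andP[a' l']; apply/andP; split; last exact: ltn_trans l'.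
exact: anc_trans a'.
Qed.

Lemma anc_uncovered v x : top f v -> strict_anc f v x -> ~~ covered f x -> x < v.
Proof.
move=> /andP[mv _] a ncx; have := anc_neq forest_f a.
have : ~~ (v < x); last by lia.
by apply: contra ncx => l; apply/existsP; exists v; rewrite mv /upper a.
Qed.

(** If the covering vertex is itself covered by [w], then [w] also covers [x] and has a smaller
    label, so the descent ends at a top. *)
Lemma covered_top x : covered f x -> exists2 v, top f v & upper f v x.
Proof.
move=> /existsP[v]; elim/ltn_ind: {v}(val v) {-2}v (erefl (val v)) => k IH v kv.
move=> /andP[mv uv]; have [/existsP[w /andP[mw uw]]|ncv] := boolP (covered f v).
  apply: (IH w _ w) => //; first by rewrite -kv; case/andP: uw.
  by rewrite mw (upper_trans uw uv).
by exists v => //; rewrite /top mv.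
Qed.

(** Both tops are ancestors of [x]. If [v] is above [w], then [w < v] since [w] is uncovered, and
    [v], [w], [x] form a 213. *)
Lemma top_uniq v w x : top f v -> top f w -> upper f v x -> upper f w x -> v = w.
Proof.
have aux v' w' : top f v' -> top f w' -> upper f v' x -> upper f w' x ->
    ~ strict_anc f v' w'.
  move=> tv /andP[_ ncw] uv /andP[aw lw] a.
  by apply: (av a aw); [apply: anc_uncovered | case/andP: uv].
move=> tv tw uv uw; case/andP: (uv) => av' _; case/andP: (uw) => aw _.
by case: (anc_comparable forest_f av' aw) => // /aux []; eauto.
Qed.

Lemma blockP v x : reflect (block f x = Some v) (top f v && upper f v x).
Proof.
rewrite /block; case: pickP => [w /andP[tw uw]|H]; last by rewrite H; constructor.
apply: (iffP andP) => [[tv uv]|[<-]//].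
by rewrite (top_uniq tv tw uv uw).
Qed.

Lemma block_None x : (block f x == None) = ~~ covered f x.
Proof.
have [/covered_top[v tv uv]|ncx] := boolP (covered f x).
  have/blockP -> // : top f v && upper f v x by rewrite tv.
apply/eqP; rewrite /block; case: pickP => // v /andP[/andP[mv _] uv].
by case/existsP: ncx; exists v; rewrite mv.
Qed.

Lemma flip_id x : ~~ covered f x -> flip f x = x.
Proof. by rewrite -block_None /flip => /eqP ->. Qed.

Lemma block_flip x : block f (flip f x) = block f x.
Proof.
rewrite {1}/flip; case E: (block f x) => [v|] //.
have : x \in enum [set y | block f y == Some v] by rewrite mem_enum inE E.
by move/rev_in_in; rewrite mem_enum inE => /eqP.
Qed.

Let ltn_ord_irr : irreflexive (fun x y : 'I_n => x < y).
Proof. by move=> x; apply: ltnn. Qed.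

Let ltn_ord_trans : transitive (fun x y : 'I_n => x < y).
Proof. by move=> y x z; apply: ltn_trans. Qed.

Lemma flipK : involutive (flip f).
Proof.
move=> x; rewrite {1}/flip block_flip /flip; case E: (block f x) => [v|] //.
apply: rev_inK ltn_ord_irr ltn_ord_trans (sorted_enum_ord _) _ _.
by rewrite mem_enum inE E.
Qed.

Lemma flip_lt x y : block f x = block f y -> covered f x -> x < y ->
  flip f y < flip f x.
Proof.
move=> Exy; have := block_None x; rewrite /flip -Exy.
case E: (block f x) => [v|] /=; last by case: (covered f x).
move=> _ _ xy; apply: (rev_in_lt ltn_ord_irr ltn_ord_trans (sorted_enum_ord _)) => //.
  by rewrite mem_enum inE E.
by rewrite mem_enum inE -Exy E.
Qed.

(** If [w > v], then [w] cannot be a descendant of [v], so it is an ancestor, and 213-avoidance puts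
    all of [F v] below it. *)
Lemma block_separated v u w : upper f v u -> ~~ upper f v w ->
  strict_anc f u w \/ strict_anc f w u ->
  w <= v \/ forall x, upper f v x -> x < w.
Proof.
move=> /andP[avu lvu] nvw C; case: (leqP w v) => lvw; [by left | right].
have awv : strict_anc f w v.
  have nvw' : ~~ strict_anc f v w by apply: contra nvw => a; rewrite /upper a.
  case: C => [a|a]; first by rewrite (anc_trans forest_f avu a) in nvw'.
  have [E|//|a'] := anc_comparable forest_f a avu; first by rewrite E ltnn in lvw.
  by rewrite a' in nvw'.
move=> x /andP[avx lvx]; have := anc_neq forest_f (anc_trans forest_f awv avx).
by have := av awv avx lvw; lia.
Qed.

(** One top is an ancestor of the other. The lower one, being uncovered, has the smaller label, and
    by 213-avoidance so does its whole block. *)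
Lemma blocks_separated v w x y : top f v -> top f w -> v != w ->
  upper f v x -> upper f w y -> strict_anc f x y \/ strict_anc f y x ->
  (forall z, upper f w z -> z < v) \/ (forall z, upper f v z -> z < w).
Proof.
have aux v' w' : top f v' -> top f w' -> strict_anc f v' w' ->
    forall z, upper f w' z -> z < v'.
  move=> tv /andP[_ ncw] a z /andP[az lz].
  have l := anc_uncovered tv a ncw.
  by have := av a az l; have := anc_neq forest_f (anc_trans forest_f a az); lia.
move=> tv tw nvw /andP[ax _] /andP[ay _] C.
suff [E|a|a] : [\/ v = w, strict_anc f v w | strict_anc f w v].
- by rewrite E eqxx in nvw.
- by left; apply: aux.
- by right; apply: aux.
case: C => a.
  exact: anc_comparable (anc_trans forest_f ax a) ay.
exact: anc_comparable ax (anc_trans forest_f ay a).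
Qed.

Lemma flip_upper v x : top f v -> upper f v x -> upper f v (flip f x).
Proof.
move=> tv uv; have /blockP E : top f v && upper f v x by rewrite tv.
by have /blockP/andP[] : block f (flip f x) = Some v by rewrite block_flip.
Qed.

(** By the separation lemmas such a comparison depends only on the blocks involved, and [flip] maps
    each block to itself. *)
Lemma flip_order x y : strict_anc f x y \/ strict_anc f y x ->
  ~~ covered f x \/ block f x != block f y -> (flip f x < flip f y) = (x < y).
Proof.
move=> C D; have [cx|ncx] := boolP (covered f x); have [cy|ncy] := boolP (covered f y).
- have {}D : block f x != block f y by case: D; rewrite ?cx.
  have [v tv uv] := covered_top cx; have [w tw uw] := covered_top cy.
  have nvw : v != w.
    have /blockP Ev : top f v && upper f v x by rewrite tv.
    have /blockP Ew : top f w && upper f w y by rewrite tw.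
    by apply: contra D => /eqP E; rewrite Ev Ew E.
  have := flip_upper tv uv; have := flip_upper tw uw => uw' uv'.
  case: (blocks_separated tv tw nvw uv uw C) => H.
    have := H _ uw; have := H _ uw'; case/andP: uv uv' => _ l /andP[_ l']; lia.
  have := H _ uv; have := H _ uv'; case/andP: uw uw' => _ l /andP[_ l']; lia.
- rewrite (flip_id ncy); have [v tv uv] := covered_top cx.
  have nu : ~~ upper f v y.
    by apply: contra ncy => u; apply/existsP; exists v; rewrite u; case/andP: tv => ->.
  have uv' := flip_upper tv uv.
  case: (block_separated uv nu C) => H.
    by case/andP: uv uv' => _ l /andP[_ l']; lia.
  by have := H _ uv; have := H _ uv'; lia.
- rewrite (flip_id ncx); have [v tv uv] := covered_top cy.
  have nu : ~~ upper f v x.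
    by apply: contra ncx => u; apply/existsP; exists v; rewrite u; case/andP: tv => ->.
  have uv' := flip_upper tv uv.
  have C' : strict_anc f y x \/ strict_anc f x y by case: C; auto.
  case: (block_separated uv nu C') => H.
    by case/andP: uv uv' => _ l /andP[_ l']; lia.
  by have := H _ uv; have := H _ uv'; lia.
- by rewrite !flip_id.
Qed.

Lemma monotone_block d x y : monotone d f -> covered f x ->
  block f x = block f y -> strict_anc f x y -> (x < y) = d.
Proof.
move=> md /covered_top[v tv uv] E.
have /blockP Ev : top f v && upper f v x by rewrite tv.
have /blockP/andP[_ uv'] : block f y = Some v by rewrite -E.
by apply: md uv uv'; case/andP: tv.
Qed.

Hypothesis p_inj : forall i j, i <= M -> j <= M -> p i = p j -> i = j.

(** A covered vertex of the occurrence lies in the block of a top [v], and [v > s] because [s] is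
    uncovered. By induction [v] ends an occurrence without covered vertices, from which [exchange]
    imports entries. *)
Lemma uncovered_occ s : marked p M f s -> ~~ covered f s ->
  exists I, [/\ occ f p M I, I M = s & forall q, q <= M -> ~~ covered f (I q)].
Proof.
elim/ltn_ind: {s}(n - s) {-2}s (erefl (n - s)) => k IH s ks ms ncs.
(* The entries from [c] on are already uncovered; [c] is brought down to 0. *)
suff H c I : occ f p M I -> I M = s ->
    (forall q, c <= q -> q <= M -> ~~ covered f (I q)) ->
    exists I, [/\ occ f p M I, I M = s & forall q, q <= M -> ~~ covered f (I q)].
  case/markedP: (ms) => I oI IM; apply: (H M I oI IM) => q Mq qM.
  by have -> : q = M; [lia | rewrite IM].
elim: c I => [|c IHc] I oI IM nc; first by exists I; split=> // q; apply: nc.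
have [|cI] := boolP ((c <= M) && covered f (I c)); last first.
  apply: (IHc I oI IM) => q; rewrite leq_eqVlt => /orP[/eqP <- cM|]; last exact: nc.
  by rewrite cM in cI.
case/andP=> cM /covered_top[v tv uv].
have {}cM : c < M.
  rewrite ltn_neqAle cM andbT; apply/eqP => E; case/existsP: ncs; exists v.
  by have -> : s = I c; [rewrite E | rewrite uv; case/andP: tv => ->].
case/andP: (uv) => avc lvc.
have after q : c < q -> q <= M -> I q < v.
  move=> cq qM; apply: anc_uncovered (nc q cq qM) => //.
  by apply: anc_trans avc _ => //; have [] := oI c q cq qM.
have sv : s < v by rewrite -IM; apply: after.
have [J [oJ JM ncJ]] : exists J, [/\ occ f p M J, J M = v &
    forall q, q <= M -> ~~ covered f (J q)].
  case/andP: tv => mv ncv; apply: (IH (n - v)) => //.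
  by have := ltn_ord v; lia.
have [||||K [c' [e [oK cc ce eM KE]]]] := exchange forest_f av p_inj oI oJ cM.
- by rewrite JM.
- by rewrite JM.
- by rewrite JM IM.
- by move=> q cq qM; rewrite JM ltnW // after.
(* The last entry is kept since [e <= M]. Each entry from [c] on is either imported, hence
   uncovered, or an old one beyond [c]. *)
apply: (IHc K oK); first by rewrite KE; case: ifP => //; lia.
move=> q cq qM; rewrite KE; case: ifP => h; first exact: ncJ.
by apply: nc => //; lia.
Qed.

End OneForest.

(** * The flipped forest: 213-avoidance, same blocks, opposite monotonicity *)

Section Flipped.
Variable f : parent_fun n.
Hypotheses (forest_f : is_forest f) (av : avoids213 f).
Hypothesis p_inj : forall i j, i <= M -> j <= M -> p i = p j -> i = j.
Variable d : bool.
Hypothesis mono : monotone d f.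

Let g := relabel f (flip f).
Let fK : involutive (flip f) := @flipK f.

Let anc_g u v : strict_anc g u v = strict_anc f (flip f u) (flip f v).
Proof. exact: anc_relabel. Qed.

Let forest_g : is_forest g.
Proof. exact: is_forest_relabel. Qed.

Lemma flipped_avoids213 : avoids213 g.
Proof.
move=> x' y' z'; rewrite !anc_g.
set x := flip f x'; set y := flip f y'; set z := flip f z'.
rewrite -(fK x') -(fK y') -(fK z') -/x -/y -/z => axy ayz lyx lxz.
have axz := anc_trans forest_f axy ayz.
have order := flip_order forest_f av.
pose same u w := covered f u && (block f u == block f w).
have ord u w : strict_anc f u w \/ strict_anc f w u -> ~~ same u w ->
    (flip f u < flip f w) = (u < w).
  by move=> C; rewrite negb_and => /orP D; apply: order.
have same_upper u w : same u w -> exists2 v, top f v & upper f v u /\ upper f v w.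
  case/andP=> /(covered_top forest_f)[v tv uv] /eqP E; exists v => //; split=> //.
  have /(blockP forest_f av) Ev : top f v && upper f v u by rewrite tv.
  by have /(blockP forest_f av)/andP[] : block f w = Some v by rewrite -E.
have upper_same v u w : top f v -> upper f v u -> upper f v w -> same u w.
  move=> tv uu uw; apply/andP; split.
    by apply/existsP; exists v; rewrite uu andbT; case/andP: tv.
  have /(blockP forest_f av) -> : top f v && upper f v u by rewrite tv.
  by have /(blockP forest_f av) -> : top f v && upper f v w by rewrite tv.
have same_sym u w : same u w -> same w u.
  by move=> /same_upper[v tv [uu uw]]; apply: upper_same tv uw uu.
(* In one common block, [x < y] and [x < z] have the same truth value [d], and [flip] reverses both,
   which excludes a 213. If only [x] and [y] share a block, then [x < z] forces [z] into it. *)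
have [sxy|nxy] := boolP (same x y).
  have [sxz|nxz] := boolP (same x z).
    have [v tv [ux uy]] := same_upper _ _ sxy; have [w tw [ux' uz]] := same_upper _ _ sxz.
    have E := top_uniq forest_f av tv tw ux ux'; rewrite -{w tw ux'}E in uz.
    case/andP: (tv) => mv _.
    case/andP: sxy => cx /eqP Exy; case/andP: sxz => _ /eqP Exz.
    have := mono mv ux uy axy; have := mono mv ux uz axz.
    have := @flip_lt f forest_f av x z Exz cx.
    have cy : covered f y by apply/existsP; exists v; rewrite mv.
    have := @flip_lt f forest_f av y x (esym Exy) cy.
    have := anc_neq forest_f axy.
    case: d; lia.
  have xz : x < z by rewrite -ord; auto.
  have [v tv [ux uy]] := same_upper _ _ sxy.
  have uz : upper f v z by apply: upper_trans ux _ => //; rewrite /upper axz.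
  by rewrite (upper_same v) in nxz.
have yx : y < x by rewrite -ord //; [auto | apply: contra nxy; apply: same_sym].
have [syz|nyz] := boolP (same y z).
  have [v tv [uy uz]] := same_upper _ _ syz.
  apply: (av axy ayz yx); rewrite -ord //; auto.
  apply: contra nxy => /same_upper[w tw [ux uz']].
  have E := top_uniq forest_f av tv tw uz uz'; rewrite -{w tw uz'}E in ux.
  exact: upper_same ux uy.
(* With [v] the top of [x] and [z], either [v], [y], [z] is a 213 or [y] belongs to the block as
   well. *)
have [sxz|nxz] := boolP (same x z).
  have [v tv [ux uz]] := same_upper _ _ sxz.
  have ay : strict_anc f v y by apply: anc_trans axy => //; case/andP: ux.
  have [|vy] := ltnP y v.
    by move=> yv; apply: (av ay ayz yv); case/andP: uz.
  case/negP: nxy; apply: upper_same tv ux _; rewrite /upper ay /=.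
  by have := anc_neq forest_f ay; lia.
by apply: (av axy ayz yx); rewrite -ord; auto.
Qed.

Let av_g := flipped_avoids213.

Lemma occ_flipped I : (forall q, q <= M -> ~~ covered f (I q)) ->
  occ g p M I <-> occ f p M I.
Proof.
move=> nc; have anc_gf i j : i < j -> j <= M ->
    strict_anc g (I i) (I j) = strict_anc f (I i) (I j).
  by move=> ij jM; rewrite anc_g !flip_id // nc //; lia.
by split=> o i j ij jM; have [a l] := o i j ij jM; split=> //;
  [rewrite -anc_gf | rewrite anc_gf].
Qed.

Lemma upper_flipped v x : ~~ covered f v -> upper g v x = upper f v (flip f x).
Proof.
move=> ncv; rewrite /upper anc_g (flip_id forest_f av ncv).
case a: (strict_anc f _ _) => //=.
have := @flip_order f forest_f av v (flip f x).
by rewrite fK (flip_id forest_f av ncv) => ->; auto.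
Qed.

Lemma upper_top_flipped v x : top f v -> upper g v x = upper f v x.
Proof.
move=> tv; rewrite upper_flipped; last by case/andP: tv.
apply/idP/idP => u; last exact: flip_upper.
by rewrite -(fK x); apply: flip_upper.
Qed.

Lemma top_marked_flipped v : top f v -> marked p M g v.
Proof.
case/andP=> mv ncv; have [I [oI IM nc]] := uncovered_occ forest_f av p_inj mv ncv.
by apply/markedP; exists I => //; apply/occ_flipped.
Qed.

Lemma covered_flipped x : covered f x -> covered g x.
Proof.
case/(covered_top forest_f)=> v tv uv; apply/existsP; exists v.
by rewrite upper_top_flipped // uv top_marked_flipped.
Qed.

(** [uncovered_occ] applies to both [f] and [g]. The occurrences it gives avoid the vertices covered
    in [f], so [flip] fixes them and they occur in both forests. *)
Lemma top_flipped v : top g v = top f v.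
Proof.
have gf w : top g w -> top f w.
  case/andP=> mw ncw; have ncfw := contra (@covered_flipped w) ncw.
  have [I [oI IM nc]] := uncovered_occ forest_g av_g p_inj mw ncw.
  rewrite /top ncfw andbT; apply/markedP; exists I => //; apply/occ_flipped => // q qM.
  exact: contra (@covered_flipped _) (nc q qM).
apply/idP/idP => [|tv]; first exact: gf.
rewrite /top top_marked_flipped //=; apply/negP => /(covered_top forest_g)[w /gf tw].
rewrite upper_top_flipped // => u; case/andP: tv => _ /existsP; apply.
by exists w; rewrite u; case/andP: tw => ->.
Qed.

Lemma block_flipped x : block g x = block f x.
Proof.
apply: eq_pick => v; rewrite /= top_flipped.
by case tv: (top f v); rewrite //= upper_top_flipped.
Qed.

Lemma flip_flipped x : flip g x = flip f x.
Proof.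
rewrite /flip block_flipped; case: (block f x) => // v.
suff -> : [set y | block g y == Some v] = [set y | block f y == Some v] by [].
by apply/setP => y; rewrite !inE block_flipped.
Qed.

Lemma flipped_monotone : monotone (~~ d) g.
Proof.
move=> v x y mv ux uy; rewrite anc_g => a.
(* Passing to a top moves the claim into a block common to [f] and [g]. *)
have [w tw [uwx uwy]] : exists2 w, top g w & upper g w x /\ upper g w y.
  have [/(covered_top forest_g)[w tw uw]|ncv] := boolP (covered g v).
    by exists w => //; split; apply: upper_trans uw _.
  by exists v => //; rewrite /top mv.
rewrite top_flipped in tw; rewrite !upper_top_flipped // in uwx uwy.
have /(blockP forest_f av) Ex : top f w && upper f w x by rewrite tw.
have /(blockP forest_f av) Ey : top f w && upper f w y by rewrite tw.
have cov z : upper f w z -> covered f z.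
  by move=> u; apply/existsP; exists w; rewrite u; case/andP: tw => ->.
have Exy : block f x = block f y by rewrite Ex.
have := monotone_block forest_f av mono (cov _ (flip_upper forest_f av tw uwx)).
move/(_ (flip f y)); rewrite !block_flip // => /(_ Exy a).
have := @flip_lt f forest_f av x y Exy (cov x uwx).
have := @flip_lt f forest_f av y x (esym Exy) (cov y uwy).
have nxy : x != y :> nat.
  apply/eqP => E; apply: (anc_irr forest_f (v := flip f x)).
  by rewrite {2}(val_inj E).
case: d; lia.
Qed.

End Flipped.
End Blocks.

(** * The flip as an injection *)

Section Count.
Variables (n : nat) (p : nat -> nat) (M : nat).
Hypothesis p_inj : forall i j, i <= M -> j <= M -> p i = p j -> i = j.

(** The flipped forest has the same [flip], so flipping twice restores [f]. *)
Lemma flip_card (S S' : {set parent_fun n}) d :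
  (forall f, f \in S -> [/\ is_forest f, avoids213 f & monotone p M d f]) ->
  (forall f, is_forest f -> avoids213 f -> monotone p M (~~ d) f -> f \in S') ->
  #|S| <= #|S'|.
Proof.
move=> HS HS'; pose Phi (f : parent_fun n) := relabel f (flip p M f).
have PhiK : {in S, cancel Phi Phi}.
  move=> f /HS[ff av mono]; apply/ffunP => x.
  have E := flip_flipped ff av p_inj mono.
  rewrite ffunE E ffunE flipK.
  by case: (f x) => //= y; rewrite E flipK.
rewrite -(card_in_imset (can_in_inj PhiK)); apply: subset_leq_card.
apply/subsetP => _ /imsetP[f /HS[ff av mono] ->]; apply: HS'.
- by apply: is_forest_relabel => //; apply: flipK.
- exact: flipped_avoids213 mono.
- exact: flipped_monotone mono.
Qed.

End Count.

(** * Avoidance expressed by monotonicity *)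

Lemma contains213P n (f : parent_fun n) : is_forest f ->
  ~~ contains f [:: 2; 1; 3] <-> avoids213 f.
Proof.
move=> ff; have C := containsP (q := [:: 2; 1; 3]) (M := 2) ff isT erefl.
split=> [/C nC x y z axy ayz yx xz | av]; last first.
  apply/C => -[I oI]; have [//|//|a01 l01] := oI 0 1.
  have [//|//|a12 _] := oI 1 2; have [//|//|_ l02] := oI 0 2.
  apply: (av _ _ _ a01 a12); last by rewrite l02.
  by have := anc_neq ff a01; move: l01 => /=; lia.
have axz := anc_trans ff axy ayz.
(* The default value [z] supplies the entry of index 2. *)
apply: nC; exists (fun i => nth z [:: x; y] i).
by move=> [|[|[|i]]] [|[|[|j]]] //= _ _; split=> //; lia.
Qed.

Section Ending.
Variables (n : nat) (f : parent_fun n) (p : nat -> nat) (M : nat) (q : seq nat).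
Hypotheses (forest_f : is_forest f) (av : avoids213 f).
Hypotheses (uniq_q : uniq q) (size_q : size q = M.+3).
Hypothesis pq : forall i, i <= M -> nth 0 q i = p i.
Hypotheses (last1 : p M < nth 0 q M.+1) (last2 : p M < nth 0 q M.+2).
Hypothesis adjacent1 : forall i, i < M -> (p i < nth 0 q M.+1) = (p i < p M).
Hypothesis adjacent2 : forall i, i < M -> (p i < nth 0 q M.+2) = (p i < p M).

(** An occurrence of [q] is one of [p] ending at some [v], followed by two vertices of [F v] on a
    path in the order of the last two entries; avoidance forces the opposite order. *)
Lemma avoids_ending :
  ~~ contains f q <-> monotone p M (~~ (nth 0 q M.+1 < nth 0 q M.+2)) f.
Proof.
have C := containsP forest_f uniq_q size_q.
split=> [/C nC v x y /markedP[I oI IM] ux uy axy|mono]; last first.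
  apply/C => -[I oI].
  have [||a1 l1] := oI M M.+1; try lia.
  have [||a2 l2] := oI M M.+2; try lia.
  have [||a3 l3] := oI M.+1 M.+2; try lia.
  have mI : marked p M f (I M).
    apply/markedP; exists I => // i j ij jM.
    by have [||a l] := oI i j; [lia | lia | rewrite -!pq //; lia].
  have := mono _ (I M.+1) (I M.+2) mI.
  rewrite /upper a1 a2 l1 l2 l3 pq // last1 last2 => /(_ isT isT a3).
  by case: (_ < _).
(* Every vertex of [F v] compares to the occurrence as the pattern requires: an entry above [v]
   exceeds all of [F v] by 213-avoidance. *)
have ext z i : upper f v z -> i <= M ->
    strict_anc f (I i) z /\ (I i < z) = (i == M) || (p i < p M).
  move=> /andP[avz lvz]; rewrite leq_eqVlt => /orP[/eqP ->|iM].
    by rewrite IM eqxx avz lvz.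
  have [//|//|a l] := oI i M; rewrite IM in a l.
  split; first exact: anc_trans avz.
  rewrite ltn_eqF //= -l; have := av a avz; have := anc_neq forest_f a.
  by case: (ltnP (I i) v); lia.
suff : (x < y) <> (nth 0 q M.+1 < nth 0 q M.+2) by do 2!case: (_ < _).
move=> E; apply: nC; exists (fun i => if i <= M then I i else if i == M.+1 then x else y).
move=> i j ij jM /=; case: (leqP j M) => [jM'|Mj].
  have iM : i <= M by lia.
  by rewrite iM !pq //; apply: oI.
have [iM|Mi] := leqP i M; last first.
  have -> : i = M.+1 by lia.
  have -> : j = M.+2 by lia.
  have -> : (M.+2 == M.+1) = false by lia.
  by rewrite eqxx.
rewrite pq //; case: eqP => [->|ne].
  have [a ->] := ext x i ux iM; split=> //.
  by case: eqP => [-> //|ne]; rewrite adjacent1 //; lia.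
have -> : j = M.+2 by lia.
have [a ->] := ext y i uy iM; split=> //.
by case: eqP => [-> //|ne']; rewrite adjacent2 //; lia.
Qed.

End Ending.

(** * The two patterns and the equality of counts *)

Lemma take_last2 M (q : seq nat) : size q = M.+3 ->
  q = take M.+1 q ++ [:: nth 0 q M.+1; nth 0 q M.+2].
Proof.
move=> sq; rewrite -{1}(cat_take_drop M.+1 q); congr (_ ++ _).
by do 2!rewrite (drop_nth 0) ?sq //; rewrite drop_oversize ?sq.
Qed.

Theorem theorem1p3 (k : nat) (pi : seq nat) :
  3 <= k -> size pi = k -> perm_eq pi (iota 1 k) ->
  nth 0 pi (k - 1) = nth 0 pi (k - 2) + 1 ->
  nth 0 pi (k - 1) = nth 0 pi (k - 3) + 2 ->
  forall n : nat,
    num_avoiding [:: [:: 2; 1; 3]; pi] n =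
    num_avoiding [:: [:: 2; 1; 3]; swap_last2 pi] n.
Proof.
(* Counting from 0, [M = k - 3] is the index of the last entry of the shortened pattern. *)
move=> k3 sz perm; have [M kE] : exists M, k = M.+3 by exists (k - 3); lia.
have -> : k - 1 = M.+2 by lia.
have -> : k - 2 = M.+1 by lia.
have -> : k - 3 = M by lia.
have {perm} upi : uniq pi by rewrite (perm_uniq perm) iota_uniq.
rewrite {k k3}kE in sz *; move=> e1 e2 n.
have swE : swap_last2 pi = take M.+1 pi ++ [:: nth 0 pi M.+2; nth 0 pi M.+1].
  by rewrite /swap_last2 sz !subSS !subn0.
set sw := swap_last2 pi in swE *.
have st : size (take M.+1 pi) = M.+1 by rewrite size_takel // sz; lia.
have ssw : size sw = M.+3 by rewrite swE size_cat st /= addn2.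
have usw : uniq sw.
  have : perm_eq sw pi.
    by rewrite swE [X in perm_eq _ X](take_last2 sz) perm_cat2l
      (perm_catC [:: _] [:: _]).
  by move/perm_uniq ->.
have nsw i : i <= M -> nth 0 sw i = nth 0 pi i.
  by move=> iM; rewrite swE nth_cat st ltnS iM nth_take.
have sw1 : nth 0 sw M.+1 = nth 0 pi M.+2 by rewrite swE nth_cat st ltnn subnn.
have sw2 : nth 0 sw M.+2 = nth 0 pi M.+1.
  by rewrite swE nth_cat st ltnNge leqnSn /= subSnn.
have p_inj i j : i < M.+3 -> j < M.+3 -> nth 0 pi i = nth 0 pi j -> i = j.
  by move=> iM jM /eqP; rewrite nth_uniq ?sz // => /eqP.
(* The last three entries of [pi] are consecutive values and the entries are distinct, so no earlier
   one lies between them. *)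
have adj i : i < M -> (nth 0 pi i < nth 0 pi M.+1) = (nth 0 pi i < nth 0 pi M) /\
    (nth 0 pi i < nth 0 pi M.+2) = (nth 0 pi i < nth 0 pi M).
  move=> iM; have := p_inj i M; have := p_inj i M.+1; have := p_inj i M.+2; lia.
have setE q d : (forall f : parent_fun n, is_forest f -> avoids213 f ->
      ~~ contains f q <-> monotone (nth 0 pi) M d f) ->
    forall f, f \in [set par : parent_fun n | is_forest par &&
        avoids par [:: [:: 2; 1; 3]; q]]
      <-> [/\ is_forest f, avoids213 f & monotone (nth 0 pi) M d f].
  move=> H f; rewrite inE /avoids /= andbT; split=> [/and3P[ff c1 c2]|[ff c1 c2]].
    by have av := (contains213P ff).1 c1; split=> //; apply/H.
  by apply/and3P; split=> //; [apply/contains213P | apply/H].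
have /setE Spi f : is_forest f -> avoids213 f ->
    ~~ contains f pi <-> @monotone n (nth 0 pi) M false f.
  move=> ff av; have -> : false = ~~ (nth 0 pi M.+1 < nth 0 pi M.+2) by lia.
  by apply: avoids_ending => //; try lia; move=> i /adj[].
have /setE Ssw f : is_forest f -> avoids213 f ->
    ~~ contains f sw <-> @monotone n (nth 0 pi) M true f.
  move=> ff av; have -> : true = ~~ (nth 0 sw M.+1 < nth 0 sw M.+2).
    by rewrite sw1 sw2; lia.
  by apply: avoids_ending => //; rewrite ?sw1 ?sw2; try lia; move=> i /adj[].
have p_injM i j : i <= M -> j <= M -> nth 0 pi i = nth 0 pi j -> i = j.
  by move=> iM jM; apply: p_inj; lia.
(* The flip injects each of the two families into the other. *)
apply/eqP; rewrite eqn_leq; apply/andP; split.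
  apply: (flip_card (d := false) p_injM) => f; first exact: (Spi f).1.
  by move=> ff av mono; apply: (Ssw f).2.
apply: (flip_card (d := true) p_injM) => f; first exact: (Ssw f).1.
by move=> ff av mono; apply: (Spi f).2.
Qed.
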